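(* Let $A$ be a compact Hausdorff MV-algebra. The following are equivalent: (1) $A$ is projective in $\mathbb{CHMV}$, i.e. for every surjective continuous homomorphism $\psi:C\to B$ between compact Hausdorff MV-algebras and every continuous homomorphism $\varphi:A\to B$ there exists a continuous homomorphism $\overline{\varphi}:A\to C$ with $\psi\circ\overline{\varphi}=\varphi$; (2) $A\cong Ł_2\times A'$ for some compact Hausdorff MV-algebra $A'$; (3) for every compact Hausdorff MV-algebra $B$ there exists at least one continuous MV-algebra homomorphism $A\to B$.
   Context: A compact Hausdorff MV-algebra is an MV-algebra equipped with a compact Hausdorff topology with respect to which the MV-operations $\oplus,\neg$ are continuous. $\mathbb{CHMV}$ is the category of such algebras with continuous MV-algebra homomorphisms. $Ł_2=\{0,1\}$ is the two-element Boolean algebra (as an MV-algebra, discrete topology); products carry the product topology. *)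

(* Defs.v *)
From HB Require Import structures.
From mathcomp Require Import all_boot all_order.
From mathcomp Require Import boolp classical_sets functions topology.

Set Implicit Arguments.
Unset Strict Implicit.
Unset Printing Implicit Defensive.

Local Open Scope classical_set_scope.

(* The one-element algebra is allowed: nothing requires 0 to differ from its
   negation.  The last axiom is the symmetry of the join x \/ y. *)
HB.mixin Record isMVAlgebra T := {
  mv_zero : T;
  mv_oplus : T -> T -> T;
  mv_neg : T -> T;
  mv_oplusA : associative mv_oplus;
  mv_oplusC : commutative mv_oplus;
  mv_oplusx0 : right_id mv_zero mv_oplus;
  mv_negK : involutive mv_neg;
  mv_oplusx1 : right_zero (mv_neg mv_zero) mv_oplus;
  mv_joinC : forall x y : T,
    mv_oplus (mv_neg (mv_oplus (mv_neg x) y)) y =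
    mv_oplus (mv_neg (mv_oplus (mv_neg y) x)) x
}.

#[short(type="mvType")]
HB.structure Definition MVAlgebra := {T of isMVAlgebra T}.

Definition mv_hom (A B : mvType) (f : A -> B) : Prop :=
  [/\ f mv_zero = mv_zero,
      forall x y, f (mv_oplus x y) = mv_oplus (f x) (f y) &
      forall x, f (mv_neg x) = mv_neg (f x)].

HB.mixin Record isCompactHausdorffMV T of MVAlgebra T & Topological T := {
  mv_oplus_continuous : continuous (fun p : T * T => mv_oplus p.1 p.2);
  mv_neg_continuous : continuous (mv_neg : T -> T);
  chmv_compact : compact [set: T];
  chmv_hausdorff : hausdorff_space T
}.

#[short(type="chmvType")]
HB.structure Definition CompactHausdorffMV :=
  {T of isCompactHausdorffMV T & MVAlgebra T & Topological T}.

Definition chmv_hom (A B : chmvType) (f : A -> B) : Prop :=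
  mv_hom f /\ continuous f.

Definition chmv_iso (A B : chmvType) : Prop :=
  exists (f : A -> B) (g : B -> A),
    [/\ chmv_hom f, chmv_hom g, cancel f g & cancel g f].

Definition chmv_projective (A : chmvType) : Prop :=
  forall (B C : chmvType) (psi : C -> B) (phi : A -> B),
    chmv_hom psi -> set_surj [set: C] [set: B] psi -> chmv_hom phi ->
    exists2 phibar : A -> C, chmv_hom phibar & psi \o phibar =1 phi.

(* bool, with orb, negb and the discrete topology, is the two-element algebra. *)
Section BoolMV.

Let bool_oplusx1 : right_zero (~~ false) orb.
Proof. by case. Qed.

Let bool_joinC (x y : bool) :
  ~~ (~~ x || y) || y = ~~ (~~ y || x) || x.
Proof. by case: x; case: y. Qed.

HB.instance Definition _ :=
  isMVAlgebra.Build bool orbA orbC orbF negbK bool_oplusx1 bool_joinC.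

Let bool_oplus_continuous :
  continuous (fun p : bool * bool => mv_oplus p.1 p.2).
Proof.
move=> [a b] /= U /= /principal_filterP Uab.
exists ([set a], [set b]).
  by split; apply/principal_filterP.
by move=> [x y] [/= -> ->].
Qed.

Let bool_neg_continuous : continuous (mv_neg : bool -> bool).
Proof.
move=> a U /= /principal_filterP Ua.
by apply/principal_filterP.
Qed.

HB.instance Definition _ := isCompactHausdorffMV.Build bool
  bool_oplus_continuous bool_neg_continuous bool_compact
  discrete_hausdorff.

End BoolMV.

Section ProdMV.
Variables A B : mvType.
Implicit Types p q r : A * B.

Definition prod_mv_zero : A * B := (mv_zero, mv_zero).
Definition prod_mv_oplus p q : A * B :=
  (mv_oplus p.1 q.1, mv_oplus p.2 q.2).
Definition prod_mv_neg p : A * B := (mv_neg p.1, mv_neg p.2).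

Let prod_oplusA : associative prod_mv_oplus.
Proof. by move=> p q r; congr pair; exact: mv_oplusA. Qed.

Let prod_oplusC : commutative prod_mv_oplus.
Proof. by move=> p q; congr pair; exact: mv_oplusC. Qed.

Let prod_oplusx0 : right_id prod_mv_zero prod_mv_oplus.
Proof. by move=> [a b]; congr pair; exact: mv_oplusx0. Qed.

Let prod_negK : involutive prod_mv_neg.
Proof. by move=> [a b]; congr pair; exact: mv_negK. Qed.

Let prod_oplusx1 : right_zero (prod_mv_neg prod_mv_zero) prod_mv_oplus.
Proof. by move=> p; congr pair; exact: mv_oplusx1. Qed.

Let prod_joinC p q :
  prod_mv_oplus (prod_mv_neg (prod_mv_oplus (prod_mv_neg p) q)) q =
  prod_mv_oplus (prod_mv_neg (prod_mv_oplus (prod_mv_neg q) p)) p.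
Proof. by congr pair; exact: mv_joinC. Qed.

HB.instance Definition _ := isMVAlgebra.Build (A * B)%type
  prod_oplusA prod_oplusC prod_oplusx0 prod_negK prod_oplusx1 prod_joinC.

End ProdMV.

Section ProdCHMV.
Variables A B : chmvType.

Let prod_oplus_continuous :
  continuous (fun p : (A * B) * (A * B) => mv_oplus p.1 p.2).
Proof.
move=> [[a b] [c d]].
apply: cvg_pair => /=.
- have h1 : (p.1.1, p.2.1) @[p --> ((a, b), (c, d))] --> (a, c).
    apply: cvg_pair => /=.
      by apply: cvg_comp; [exact: cvg_fst | exact: cvg_fst].
    by apply: cvg_comp; [exact: cvg_snd | exact: cvg_fst].
  exact: (cvg_comp _ _ h1 (mv_oplus_continuous (a, c))).
- have h2 : (p.1.2, p.2.2) @[p --> ((a, b), (c, d))] --> (b, d).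
    apply: cvg_pair => /=.
      by apply: cvg_comp; [exact: cvg_fst | exact: cvg_snd].
    by apply: cvg_comp; [exact: cvg_snd | exact: cvg_snd].
  exact: (cvg_comp _ _ h2 (mv_oplus_continuous (b, d))).
Qed.

Let prod_neg_continuous : continuous (mv_neg : A * B -> A * B).
Proof.
move=> [a b].
apply: cvg_pair => /=.
- by apply: (cvg_comp _ _ cvg_fst); exact: mv_neg_continuous.
- by apply: (cvg_comp _ _ cvg_snd); exact: mv_neg_continuous.
Qed.

Let prod_compact : compact [set: A * B].
Proof. by rewrite -setXTT; apply: compact_setX; exact: chmv_compact. Qed.

Let prod_hausdorff : hausdorff_space (A * B)%type.
Proof.
move=> [a b] [c d] clu.
have fstP : cluster (nbhs a) c.
  move=> U V Ua Vc.
  have /(_ (U `*` setT) (V `*` setT)) [] := clu.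
  - by exists (U, setT) => //; split => //=; exact: filterT.
  - by exists (V, setT) => //; split => //=; exact: filterT.
  - by move=> [x y] [[/= Ux _] [/= Vx _]]; exists x.
have sndP : cluster (nbhs b) d.
  move=> U V Ub Vd.
  have /(_ (setT `*` U) (setT `*` V)) [] := clu.
  - by exists (setT, U) => //; split => //=; exact: filterT.
  - by exists (setT, V) => //; split => //=; exact: filterT.
  - by move=> [x y] [[/= _ Uy] [/= _ Vy]]; exists y.
by congr pair; exact: chmv_hausdorff.
Qed.

HB.instance Definition _ := isCompactHausdorffMV.Build (A * B)%type
  prod_oplus_continuous prod_neg_continuous prod_compact prod_hausdorff.

End ProdCHMV.

(* Main.v *)
(* A closed ideal of a compact MV-algebra is directed, hence by compactness has
   a largest element u, and u is idempotent.  Applied to the kernel of a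
   surjection psi : C -> B this splits C as B times the interval [0, u], with
   psi the first projection.  Consequently a hom A -> B lifts along psi as soon
   as A has a hom to [0, u], and a hom A -> {0, 1} exhibits A as a product
   {0, 1} x [0, u].  Conversely, a projective A maps to every B, by lifting
   along the surjection from B to the one-element algebra. *)
Require Import Defs.
From HB Require Import structures.
From mathcomp Require Import all_boot.
From mathcomp Require Import boolp classical_sets functions topology.

Set Implicit Arguments.
Unset Strict Implicit.
Unset Printing Implicit Defensive.

Local Open Scope classical_set_scope.

Local Notation "x ⊕ y" := (mv_oplus x y) (at level 50, left associativity).
Local Notation "¬ x" := (mv_neg x) (at level 35, right associativity).

(** * Natural order, residuation and monotonicity in an MV-algebra *)

Section MVTheory.
Variable A : mvType.
Implicit Types x y z u : A.

(** The strong (Łukasiewicz) conjunction, in general not the lattice meet. *)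
Definition mv_odot x y : A := ¬ (¬ x ⊕ ¬ y).
Local Notation "x ⊙ y" := (mv_odot x y) (at level 40, left associativity).

(** The natural order in equational form, so that the up-set of a point is the preimage of a single
    element. *)
Definition mv_le x y : Prop := ¬ x ⊕ y = ¬ mv_zero.

Lemma mv_oplus0x x : mv_zero ⊕ x = x.
Proof. by rewrite mv_oplusC mv_oplusx0. Qed.

Lemma mv_oplus1x x : ¬ mv_zero ⊕ x = ¬ mv_zero.
Proof. by rewrite mv_oplusC mv_oplusx1. Qed.

Lemma mv_oplusACA x y z t : (x ⊕ y) ⊕ (z ⊕ t) = (x ⊕ z) ⊕ (y ⊕ t).
Proof.
by rewrite -!mv_oplusA; congr mv_oplus; rewrite !mv_oplusA (mv_oplusC y).
Qed.

Lemma mv_le_refl x : mv_le x x.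
Proof.
rewrite /mv_le; have := mv_joinC x (¬ mv_zero).
by rewrite mv_oplusx1 mv_negK mv_oplus0x.
Qed.

Lemma mv_le_oplusl x y : mv_le x (x ⊕ y).
Proof. by rewrite /mv_le mv_oplusA [_ ⊕ x]mv_le_refl mv_oplus1x. Qed.

(** When [x] is below [y], their join is [y]; the other expression of that join shows that the
    truncated difference of [y] and [x] is a witness. *)
Lemma mv_leP x y : mv_le x y <-> exists z, y = x ⊕ z.
Proof.
split=> [xy|[z ->]]; last exact: mv_le_oplusl.
exists (¬ (¬ y ⊕ x)); rewrite mv_oplusC -mv_joinC.
by rewrite [¬ x ⊕ y]xy mv_negK mv_oplus0x.
Qed.

Lemma mv_le_anti x y : mv_le x y -> mv_le y x -> x = y.
Proof.
move=> xy yx; have := mv_joinC x y.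
by rewrite [¬ x ⊕ y]xy [¬ y ⊕ x]yx mv_negK !mv_oplus0x.
Qed.

Lemma mv_le_trans y x z : mv_le x y -> mv_le y z -> mv_le x z.
Proof.
move=> /mv_leP[a ->] /mv_leP[b ->]; apply/mv_leP.
by exists (a ⊕ b); rewrite mv_oplusA.
Qed.

Lemma mv_le_oplus x y z t : mv_le x y -> mv_le z t -> mv_le (x ⊕ z) (y ⊕ t).
Proof.
move=> /mv_leP[a ->] /mv_leP[b ->]; apply/mv_leP.
by exists (a ⊕ b); rewrite mv_oplusACA.
Qed.

Lemma mv_le_neg x y : mv_le x y -> mv_le (¬ y) (¬ x).
Proof. by rewrite /mv_le mv_negK mv_oplusC. Qed.

Lemma mv_odotC x y : x ⊙ y = y ⊙ x.
Proof. by rewrite /mv_odot mv_oplusC. Qed.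

Lemma mv_odotA x y z : x ⊙ (y ⊙ z) = x ⊙ y ⊙ z.
Proof. by rewrite /mv_odot !mv_negK mv_oplusA. Qed.

Lemma mv_odotx1 x : x ⊙ ¬ mv_zero = x.
Proof. by rewrite /mv_odot mv_negK mv_oplusx0 mv_negK. Qed.

Lemma mv_odot0x x : mv_zero ⊙ x = mv_zero.
Proof. by rewrite /mv_odot mv_oplus1x mv_negK. Qed.

Lemma mv_odotN x : ¬ x ⊙ x = mv_zero.
Proof. by rewrite /mv_odot [_ ⊕ ¬ x]mv_le_refl mv_negK. Qed.

Lemma mv_le_odot x y z : mv_le x y -> mv_le (x ⊙ z) (y ⊙ z).
Proof.
by move=> xy; apply/mv_le_neg/mv_le_oplus; [exact: mv_le_neg|exact: mv_le_refl].
Qed.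

Lemma mv_odot_lel x y : mv_le (x ⊙ y) x.
Proof. by rewrite -[X in mv_le _ X]mv_negK; exact/mv_le_neg/mv_le_oplusl. Qed.

(** Unfolded, both sides are the same equation up to associativity. *)
Lemma mv_residuation x y z : mv_le (x ⊙ y) z <-> mv_le x (¬ y ⊕ z).
Proof. by rewrite /mv_le /mv_odot mv_negK mv_oplusA. Qed.

Lemma mv_le_odotN x y : mv_le x y <-> x ⊙ ¬ y = mv_zero.
Proof.
rewrite /mv_le /mv_odot mv_negK; split=> [->|<-]; first by rewrite mv_negK.
by rewrite mv_negK.
Qed.

(** * Cutting down to an idempotent *)

Section Idempotent.
Variable u : A.
Hypothesis uu : u ⊕ u = u.

Lemma mv_idem_neg : ¬ u ⊕ ¬ u = ¬ u.
Proof.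
apply: mv_le_anti; last exact: mv_le_oplusl.
(* The left side is the join of [u] and [¬ u]; by symmetry it is [¬ (u ⊕ u) ⊕ u], which idempotence
   reduces to [¬ u ⊕ u]. *)
rewrite /mv_le mv_joinC mv_negK uu.
exact: mv_le_refl.
Qed.

Lemma mv_idem_odot : u ⊙ u = u.
Proof. by rewrite /mv_odot mv_idem_neg mv_negK. Qed.

(** Below [u], [x] equals its meet with [u], which is [(¬ u ⊕ x) ⊙ u]; one more factor [u] changes
    nothing. *)
Lemma mv_odot_idem x : mv_le x u -> x ⊙ u = x.
Proof.
move=> xu; have -> : x = (¬ u ⊕ x) ⊙ u.
  apply: (can_inj (@mv_negK A)); rewrite /mv_odot mv_negK.
  have := mv_joinC (¬ u) (¬ x).
  rewrite !mv_negK (mv_oplusC u) [¬ x ⊕ u]xu mv_negK mv_oplus0x => ->.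
  by rewrite (mv_oplusC x).
by rewrite -mv_odotA mv_idem_odot.
Qed.

Lemma mv_odot_oplus_idem x y : (x ⊕ y) ⊙ u = ((x ⊙ u) ⊕ (y ⊙ u)) ⊙ u.
Proof.
apply: mv_le_anti; last by apply/mv_le_odot/mv_le_oplus; exact: mv_odot_lel.
(* Doubling [u] leaves one copy to move across by residuation; the resulting [¬ u] is then doubled
   too, one copy for each summand. *)
rewrite -{1}mv_idem_odot mv_odotA; apply/mv_le_odot/mv_residuation.
rewrite -mv_idem_neg mv_oplusACA.
by apply: mv_le_oplus; apply/mv_residuation; exact: mv_le_refl.
Qed.

Lemma mv_odot_neg_idem x : ¬ x ⊙ u = ¬ (x ⊙ u) ⊙ u.
Proof.
apply: mv_le_anti; first exact/mv_le_odot/mv_le_neg/mv_odot_lel.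
rewrite -{2}mv_idem_odot mv_odotA; apply/mv_le_odot/mv_residuation.
by rewrite /mv_odot mv_negK mv_oplusC; exact: mv_le_refl.
Qed.

End Idempotent.
End MVTheory.

Local Notation "x ⊙ y" := (mv_odot x y) (at level 40, left associativity).

(** * Algebraic and continuous homomorphisms *)

Lemma mv_hom_odot (A B : mvType) (f : A -> B) (x y : A) :
  mv_hom f -> f (x ⊙ y) = f x ⊙ f y.
Proof. by move=> [_ fD fN]; rewrite /mv_odot fN fD !fN. Qed.

(** If [f x = f y], then [f] kills [x ⊙ ¬ y], whose vanishing means that [x] is below [y]; then
    exchange [x] and [y]. *)
Lemma mv_hom_inj (A B : mvType) (f : A -> B) : mv_hom f ->
  (forall x, f x = mv_zero -> x = mv_zero) -> injective f.
Proof.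
move=> fh ker0; have [_ _ fN] := fh.
have le x y : f x = f y -> mv_le x y.
  move=> fxy; apply/mv_le_odotN/ker0.
  by rewrite mv_hom_odot // fN -fxy mv_odotC mv_odotN.
by move=> x y fxy; apply: mv_le_anti; apply: le.
Qed.

Lemma mv_hom_comp (A B C : mvType) (f : A -> B) (g : B -> C) :
  mv_hom f -> mv_hom g -> mv_hom (g \o f).
Proof.
move=> [f0 fD fN] [g0 gD gN]; split=> [|x y|x] /=.
- by rewrite f0 g0.
- by rewrite fD gD.
- by rewrite fN gN.
Qed.

Lemma mv_hom_pair (A B C : mvType) (f : A -> B) (g : A -> C) :
  mv_hom f -> mv_hom g -> mv_hom (fun x => (f x, g x)).
Proof.
move=> [f0 fD fN] [g0 gD gN]; split=> [|x y|x].
- by rewrite f0 g0.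
- by rewrite fD gD.
- by rewrite fN gN.
Qed.

Lemma mv_hom_can (A B : mvType) (f : A -> B) (g : B -> A) :
  mv_hom f -> cancel f g -> cancel g f -> mv_hom g.
Proof.
move=> [f0 fD fN] fK gK; split=> [|x y|x]; apply: (can_inj fK).
- by rewrite gK f0.
- by rewrite fD !gK.
- by rewrite fN !gK.
Qed.

Lemma chmv_hom_comp (A B C : chmvType) (f : A -> B) (g : B -> C) :
  chmv_hom f -> chmv_hom g -> chmv_hom (g \o f).
Proof.
move=> [fh fc] [gh gc]; split; first exact: mv_hom_comp.
by move=> x; apply: continuous_comp; [exact: fc|exact: gc].
Qed.

Lemma chmv_hom_pair (A B C : chmvType) (f : A -> B) (g : A -> C) :
  chmv_hom f -> chmv_hom g -> chmv_hom (fun x => (f x, g x) : B * C).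
Proof.
move=> [fh fc] [gh gc]; split; first exact: mv_hom_pair.
by move=> x; apply: cvg_pair; [exact: fc|exact: gc].
Qed.

Lemma chmv_hom_fst (A B : chmvType) : chmv_hom (@fst A B).
Proof. by split=> // x; exact: cvg_fst. Qed.

(** The preimage of a closed set under [g] is its image under [f], which is compact and therefore
    closed. *)
Lemma compact_hausdorff_can_continuous (S T : topologicalType)
    (f : S -> T) (g : T -> S) :
  compact [set: S] -> hausdorff_space T -> continuous f ->
  cancel f g -> cancel g f -> continuous g.
Proof.
move=> cS hT fc fK gK; apply/continuous_closedP => D Dc.
have -> : g @^-1` D = f @` D.
  apply/seteqP; split=> [y Dgy|_ [x Dx <-]] /=; last by rewrite fK.
  by exists (g y) => //; rewrite gK.
apply: compact_closed => //; apply: continuous_compact.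
  exact: continuous_subspaceT.
exact: subclosed_compact Dc cS _.
Qed.

Lemma chmv_hom_can (A B : chmvType) (f : A -> B) (g : B -> A) :
  chmv_hom f -> cancel f g -> cancel g f -> chmv_hom g.
Proof.
move=> [fh fc] fK gK; split; first exact: mv_hom_can fK gK.
exact: compact_hausdorff_can_continuous chmv_compact chmv_hausdorff fc fK gK.
Qed.

Lemma chmv_hom_bool (B : chmvType) :
  chmv_hom (fun b : bool => if b then ¬ mv_zero else mv_zero : B).
Proof.
split; last first.
  by move=> b U /= /nbhs_singleton Ub; apply/principal_filterP.
split=> // [[] []|[]] //=.
- by rewrite mv_oplusx1.
- by rewrite mv_oplusx0.
- by rewrite mv_oplusx1.
- by rewrite mv_oplusx0.
- by rewrite mv_negK.
Qed.

Lemma chmv_hom_from_boolX (A' B : chmvType) :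
  exists f : (bool * A')%type -> B, chmv_hom f.
Proof.
by eexists; exact: chmv_hom_comp (@chmv_hom_fst _ _) (chmv_hom_bool B).
Qed.

(** * The interval below an idempotent as an MV-algebra *)

Section Interval.
Variables (C : mvType) (u : C).
Hypothesis uu : u ⊕ u = u.

(* The order interval [0, u], as the fixed points of x |-> x ⊙ u. *)
Definition idem_interval : Type := let _ := uu in set_type [set x | x ⊙ u = x].

Lemma idem_proj_subproof (x : C) :
  x ⊙ u \in [set x | x ⊙ u = x].
Proof. by apply/mem_set; rewrite /= -mv_odotA mv_idem_odot. Qed.

Definition idem_proj (x : C) : idem_interval :=
  @exist C (fun y => y \in [set x | x ⊙ u = x]) _ (idem_proj_subproof x).
Definition idem_val (x : idem_interval) : C := sval x.

Lemma idem_val_inj : injective idem_val.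
Proof. exact: val_inj. Qed.

Lemma idem_valK : cancel idem_val idem_proj.
Proof.
by move=> [x xu]; apply: idem_val_inj => /=; exact: set_mem xu.
Qed.

Definition idem_oplus x y := idem_proj (idem_val x ⊕ idem_val y).
Definition idem_neg x := idem_proj (¬ idem_val x).
Let idem_zero := idem_proj mv_zero.

(** Since [idem_proj] is onto, compatibility with the operations transfers every MV axiom from [C]
    to the interval. *)
Let projD x y : idem_proj (x ⊕ y) = idem_oplus (idem_proj x) (idem_proj y).
Proof. by apply: idem_val_inj; exact: mv_odot_oplus_idem. Qed.

Let projN x : idem_proj (¬ x) = idem_neg (idem_proj x).
Proof. by apply: idem_val_inj; exact: mv_odot_neg_idem. Qed.

Let idem_oplusA : associative idem_oplus.
Proof.
move=> x y z; rewrite -[x]idem_valK -[y]idem_valK -[z]idem_valK.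
by rewrite -!projD mv_oplusA.
Qed.

Let idem_oplusC : commutative idem_oplus.
Proof. by move=> x y; rewrite /idem_oplus mv_oplusC. Qed.

Let idem_oplusx0 : right_id idem_zero idem_oplus.
Proof. by move=> x; rewrite -[x]idem_valK -projD mv_oplusx0. Qed.

Let idem_negK : involutive idem_neg.
Proof. by move=> x; rewrite -[x]idem_valK -!projN mv_negK. Qed.

Let idem_oplusx1 : right_zero (idem_neg idem_zero) idem_oplus.
Proof. by move=> x; rewrite -[x]idem_valK -projN -projD mv_oplusx1. Qed.

Let idem_joinC x y :
  idem_oplus (idem_neg (idem_oplus (idem_neg x) y)) y =
  idem_oplus (idem_neg (idem_oplus (idem_neg y) x)) x.
Proof.
rewrite -[x]idem_valK -[y]idem_valK.
by rewrite -!(projN, projD) mv_joinC.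
Qed.

HB.instance Definition _ := isMVAlgebra.Build idem_interval
  idem_oplusA idem_oplusC idem_oplusx0 idem_negK idem_oplusx1 idem_joinC.

Lemma idem_proj_hom : mv_hom idem_proj.
Proof. by split. Qed.

End Interval.

(** * The subspace topology on the interval *)

Section IntervalCH.
Variables (C : chmvType) (u : C).
Hypothesis uu : u ⊕ u = u.
Local Notation I := (idem_interval uu).

HB.instance Definition _ :=
  Topological.copy I (set_type [set x | x ⊙ u = x]).

Lemma idem_val_continuous : continuous (@idem_val C u uu).
Proof. exact: initial_continuous. Qed.

Lemma continuous_to_idem (T : topologicalType) (f : T -> I) :
  continuous (@idem_val C u uu \o f) -> continuous f.
Proof. exact: continuous_comp_initial. Qed.

Lemma mv_oplus_continuous2 (T : topologicalType) (f g : T -> C) :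
  continuous f -> continuous g -> continuous (fun x => f x ⊕ g x).
Proof.
move=> fc gc x.
apply: (@continuous_comp _ _ _ (fun x => (f x, g x)) (fun p => p.1 ⊕ p.2)).
  by apply: cvg_pair; [exact: fc|exact: gc].
exact: mv_oplus_continuous.
Qed.

Lemma mv_neg_continuous1 (T : topologicalType) (f : T -> C) :
  continuous f -> continuous (fun x => ¬ f x).
Proof.
by move=> fc x; apply: (@continuous_comp _ _ _ f); [exact: fc|
  exact: mv_neg_continuous].
Qed.

Lemma idem_proj_continuous : continuous (@idem_proj C u uu).
Proof.
apply: continuous_to_idem; rewrite /comp/=.
apply/mv_neg_continuous1/mv_oplus_continuous2.
  exact: mv_neg_continuous.
by move=> x; exact: cvg_cst.
Qed.

Let idem_oplus_continuous : continuous (fun p : I * I => p.1 ⊕ p.2).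
Proof.
move=> p; apply: (@continuous_comp _ _ _
  (fun p : I * I => idem_val p.1 ⊕ idem_val p.2) (@idem_proj C u uu));
  last exact: idem_proj_continuous.
apply: mv_oplus_continuous2 => {}p; apply: continuous_comp;
  try exact: idem_val_continuous.
- exact: cvg_fst.
- exact: cvg_snd.
Qed.

Let idem_neg_continuous : continuous (mv_neg : I -> I).
Proof.
move=> x; apply: (@continuous_comp _ _ _ (fun x : I => ¬ idem_val x)
  (@idem_proj C u uu)); last exact: idem_proj_continuous.
by apply: mv_neg_continuous1; exact: idem_val_continuous.
Qed.

(** The interval is the image of the compact [C] under the continuous retraction [idem_proj]. *)
Let idem_compact : compact [set: I].
Proof.
have -> : [set: I] = @idem_proj C u uu @` [set: C].
  by apply/seteqP; split=> // x _; exists (idem_val x) => //; exact: idem_valK.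
apply: continuous_compact; last exact: chmv_compact.
exact/continuous_subspaceT/idem_proj_continuous.
Qed.

Let idem_hausdorff : hausdorff_space I.
Proof.
move=> x y clxy; apply/idem_val_inj/chmv_hausdorff => U V Ux Vy.
have [z [Uz Vz]] := clxy _ _ (idem_val_continuous Ux) (idem_val_continuous Vy).
by exists (idem_val z).
Qed.

HB.instance Definition _ := isCompactHausdorffMV.Build I
  idem_oplus_continuous idem_neg_continuous idem_compact idem_hausdorff.

Lemma idem_proj_chmv_hom : chmv_hom (@idem_proj C u uu : C -> I).
Proof. by split; [exact: idem_proj_hom|exact: idem_proj_continuous]. Qed.

End IntervalCH.

(** * Largest elements and the splitting of surjections *)

Lemma chmv_closed1 (C : chmvType) (x : C) : closed [set x].
Proof. exact/accessible_closed_set1/hausdorff_accessible/chmv_hausdorff. Qed.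

(* The sets of elements of K above a given one form a filter base; any cluster
   point of the filter is an upper bound. *)
Lemma closed_directed_max (C : chmvType) (K : set C) :
  closed K -> K !=set0 -> (forall x y, K x -> K y -> K (x ⊕ y)) ->
  exists2 u, K u & forall x, K x -> mv_le x u.
Proof.
move=> Kc [x0 Kx0] KD.
pose up x := K `&` [set y | mv_le x y].
have upc x : closed (up x).
  apply: closedI => //.
  rewrite -[X in closed X]/((fun y => ¬ x ⊕ y) @^-1` [set ¬ mv_zero]).
  apply: (continuous_closedP _).1; last exact: chmv_closed1.
  by apply: mv_oplus_continuous2 => y; [exact: cvg_cst|exact: cvg_id].
have FF : ProperFilter (filter_from K up).
  apply: filter_from_proper; last first.
    by move=> x Kx; exists x; split=> //; exact: mv_le_refl.
  apply: filter_from_filter; first by exists x0.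
  move=> x y Kx Ky; exists (x ⊕ y); first exact: KD.
  move=> z [Kz xyz]; split; split=> //; apply: mv_le_trans xyz.
    exact: mv_le_oplusl.
  by rewrite mv_oplusC; exact: mv_le_oplusl.
have [|u [_ uF]] := @chmv_compact C _ FF; first exact: filterT.
(* Each [up x] is closed and belongs to the filter, so it contains every cluster point. *)
have {}uF x : K x -> up x u.
  move=> Kx; move: uF; rewrite clusterE => /(_ (up x)).
  by rewrite /= -(closure_id (up x)).1 //; apply; exists x.
by exists u; [have [] := uF x0 Kx0|move=> x /uF[]].
Qed.

Lemma chmv_surj_splits (C B : chmvType) (psi : C -> B) :
  chmv_hom psi -> set_surj [set: C] [set: B] psi ->
  exists (J : chmvType) (f : C -> B * J) (g : B * J -> C),
    [/\ chmv_hom f, chmv_hom g, cancel f g, cancel g f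
      & forall x, (f x).1 = psi x].
Proof.
move=> [psih psic] psis; have [psi0 psiD psiN] := psih.
have [||x y /=|u /= psiu maxu] := @closed_directed_max C (psi @^-1` [set mv_zero]).
- by apply: (continuous_closedP _).1 => //; exact: chmv_closed1.
- by exists mv_zero.
- by rewrite psiD => -> ->; rewrite mv_oplusx0.
(* The kernel contains [u ⊕ u], which maximality puts below [u]. *)
have uu : u ⊕ u = u.
  apply: mv_le_anti; last exact: mv_le_oplusl.
  by apply: maxu; rewrite psiD psiu mv_oplusx0.
pose f x := (psi x, idem_proj uu x).
have fh : chmv_hom (f : C -> (B * idem_interval uu)%type).
  by apply: chmv_hom_pair; [split|exact: idem_proj_chmv_hom].
(* An element of the kernel of [f] is killed by [psi], so it lies below [u] and equals its own
   projection, which is zero. *)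
have finj : injective f.
  apply: (mv_hom_inj fh.1) => x fx0.
  have xu : mv_le x u by exact/maxu/(congr1 fst fx0).
  have /= xu0 := congr1 (fun p => idem_val p.2) fx0.
  by rewrite -(mv_odot_idem uu xu) xu0 mv_odot0x.
have fsurj (p : B * idem_interval uu) : exists x, f x = p.
  case: p => b z; have [c _ cb] := psis b I.
  have psiz : psi (idem_val z) = mv_zero.
    rewrite -[idem_val z](set_mem (svalP z)) mv_hom_odot // psiu.
    by rewrite mv_odotC mv_odot0x.
  have [p0 pD pN] := idem_proj_hom uu.
  (* Since [psi u] is zero, [c ⊙ ¬ u] still maps to [b], and its projection to the interval
     vanishes; [z] supplies the second coordinate without changing the first. *)
  exists (c ⊙ ¬ u ⊕ idem_val z); congr pair.
    by rewrite psiD psiz mv_oplusx0 mv_hom_odot // psiN psiu mv_odotx1.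
  rewrite pD idem_valK.
  have -> : idem_proj uu (c ⊙ ¬ u) = mv_zero.
    apply: idem_val_inj; rewrite /= -mv_odotA mv_odotN.
    by rewrite mv_odotC !mv_odot0x.
  exact: mv_oplus0x.
have [g gP] := choice fsurj.
have fK : cancel f g by move=> x; exact/finj/gP.
exists (idem_interval uu), f, g; split=> //.
exact: chmv_hom_can fh fK gP.
Qed.

(** * The three equivalent conditions *)

Lemma chmv_hom_bool_surj (A : chmvType) (f : A -> bool) :
  chmv_hom f -> set_surj [set: A] [set: bool] f.
Proof.
move=> [[f0 _ fN] _] [] _; last by exists mv_zero.
by exists (¬ mv_zero); rewrite // fN f0.
Qed.

(** The one-element algebra is realised as the interval below the idempotent zero of [B], so that
    [idem_proj] is the surjection to lift along. *)
Lemma chmv_projective_weakly_initial (A B : chmvType) :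
  chmv_projective A -> exists f : A -> B, chmv_hom f.
Proof.
move=> Aproj; have zz : mv_zero ⊕ mv_zero = mv_zero :> B by exact: mv_oplusx0.
have triv (x y : idem_interval zz) : x = y.
  apply: idem_val_inj.
  rewrite -[idem_val x](set_mem (svalP x)) -[idem_val y](set_mem (svalP y)).
  by rewrite ![_ ⊙ mv_zero]mv_odotC !mv_odot0x.
have [| | |f fh _] := Aproj _ _ (idem_proj zz) (fun=> mv_zero).
- exact: idem_proj_chmv_hom.
- by move=> x _; exists mv_zero.
- by split; [split=> *; exact: triv|exact: cst_continuous].
- by exists f.
Qed.

Theorem theorem4p4 (A : chmvType) :
  [<-> chmv_projective A;
       exists A' : chmvType, chmv_iso A (bool * A')%type;
       forall B : chmvType, exists f : A -> B, chmv_hom f].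
Proof.
tfae.
- move=> Aproj; have [f fh] := chmv_projective_weakly_initial bool Aproj.
  have [J [g [h [gh hh gK hK _]]]] :=
    chmv_surj_splits fh (chmv_hom_bool_surj fh).
  by exists J, g, h.
- move=> [A' [f [_ [fh _ _ _]]]] B.
  have [g gh] := chmv_hom_from_boolX A' B.
  by exists (g \o f); exact: chmv_hom_comp.
- move=> Ainit B C psi phi psih psis phih.
  have [J [f [g [fh gh fK gK f1]]]] := chmv_surj_splits psih psis.
  have [k kh] := Ainit J.
  (* Under [C ≅ B * J] a lift of [phi] is a map with first coordinate [phi]; any homomorphism [k] to
     [J] serves as the second. *)
  exists (g \o (fun x => (phi x, k x))) => [|x /=].
    by apply: chmv_hom_comp => //; exact: chmv_hom_pair.
  by rewrite -f1 gK.
Qed.
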